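(* Let $m,n,q,\rho$ be positive integers with $\rho<n$. Let $U\in\mathbb{R}^{m\times q}$ satisfy $\|U\|=1$ and have full numerical rank $l=\min\{m,q\}$. Let $\bar U$ be a Gaussian $m\times\rho$ matrix and $\bar V$ a Gaussian $n\times\rho$ matrix, let $A=\bar U\bar V^T$, and let $K=(U~|~A)\in\mathbb{R}^{m\times(q+n)}$. Then $$\|K\|\le\|A\|+\|U\|\le1+\nu_{m,\rho}\,\nu_{\rho,n}.$$ Furthermore, with probability 1: (i) the matrix $K$ is rank deficient or ill-conditioned if $q+\rho<m$; (ii) otherwise $K$ has full rank; and (iii) in the latter case it satisfies $$\|K^+\|\le\|U^+\|\quad\text{if }q\ge m,$$ $$\|K^+\|\le\|U^+\|\,\max\{1,\nu^+_{m-q,\rho}\,\nu^+_{\rho,n}\}\,(1+\nu_{q,\rho}\,\nu_{\rho,n})\quad\text{if }m-\rho\le q<m.$$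
   Context: $\|\cdot\|$ is the spectral norm and $M^+$ is the Moore–Penrose pseudo-inverse of $M$. A matrix is Gaussian if its entries are i.i.d. standard Gaussian (mean $0$, variance $1$) random variables; the Gaussian matrices $\bar U$ and $\bar V$ may depend on one another. $\nu_{k,h}$ and $\nu^+_{k,h}$ denote the random variables $\|G\|$ and $\|G^+\|$, respectively, for a $k\times h$ Gaussian matrix $G$, and $\nu_{k,h}=\nu_{h,k}$, $\nu^+_{k,h}=\nu^+_{h,k}$. A bound on a random quantity in terms of such variables means that there are Gaussian matrices of the indicated sizes, defined on the same probability space (not necessarily independent of the other random matrices involved), for which the bound holds. Full numerical rank $l=\min\{m,q\}$ of $U$ means that $\sigma_l(U)>\eta$ for a fixed (small) tolerance $\eta>0$, where $\sigma_1(U)\ge\sigma_2(U)\ge\cdots$ are the singular values; in particular $U$ has full rank. A matrix $M$ is ill-conditioned if its condition number $\kappa(M)=\|M\|\,\|M^+\|$ is large, i.e. exceeds a threshold fixed in advance. *)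

(* Defs.v *)
From HB Require Import structures.
From mathcomp Require Import all_boot all_order all_algebra.
From mathcomp Require Import all_classical all_reals all_analysis.
From mathcomp Require Import polyrcf.

Set Implicit Arguments.
Unset Strict Implicit.
Unset Printing Implicit Defensive.

Import Order.TTheory GRing.Theory Num.Theory.
Import numFieldNormedType.Exports.

Local Open Scope classical_set_scope.
Local Open Scope ring_scope.

Definition l2norm (R : realType) (n : nat) (x : 'cV[R]_n) : R :=
  Num.sqrt (\sum_(i < n) x i 0 ^+ 2).

(* The norm that MathComp-Analysis puts on matrices (mx_norm) is the largest
   absolute value of an entry, so the spectral norm is defined here, as the
   operator norm induced by the Euclidean norm. *)
Definition spectral_norm (R : realType) (m n : nat) (M : 'M[R]_(m, n)) : R :=
  sup [set l2norm (M *m x) | x in [set x : 'cV[R]_n | l2norm x <= 1]].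

Definition penrose (R : realType) (m n : nat)
    (M : 'M[R]_(m, n)) (X : 'M[R]_(n, m)) : Prop :=
  [/\ M *m X *m M = M, X *m M *m X = X,
      (M *m X)^T = M *m X & (X *m M)^T = X *m M].

(* MathComp's pinvmx is only a partial inverse, not the Moore-Penrose one.
   The default value 0 is never used: see penrose_mp_pinv below. *)
Definition mp_pinv (R : realType) (m n : nat) (M : 'M[R]_(m, n)) :
  'M[R]_(n, m) := xget 0 [set X | penrose M X].

Section MoorePenrose.
Variable R : realType.

Lemma penrose_unique (m n : nat) (M : 'M[R]_(m, n)) (X Y : 'M[R]_(n, m)) :
  penrose M X -> penrose M Y -> X = Y.
Proof.
move=> [MX XM sMX sXM] [MY YM sMY sYM].
have eMXY : M *m X = M *m Y.
  by rewrite -sMX -{1}MY -(mulmxA (M *m Y)) trmx_mul sMX sMY mulmxA MX.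
have eXYM : X *m M = Y *m M.
  rewrite -sXM -{1}MY 2!mulmxA -mulmxA trmx_mul sYM sXM.
  by rewrite mulmxA -(mulmxA Y) -(mulmxA Y) MX.
by rewrite -XM eXYM -mulmxA eMXY mulmxA YM.
Qed.

Lemma gram_eq0 (m n : nat) (A : 'M[R]_(m, n)) : A *m A^T = 0 -> A = 0.
Proof.
move=> AA0; apply/matrixP => i j; rewrite mxE.
have := congr1 (fun B : 'M[R]_m => B i i) AA0.
rewrite !mxE => /eqP; rewrite psumr_eq0 => [/allP/(_ j)|k _].
  by rewrite mem_index_enum mxE -expr2 sqrf_eq0 => /(_ isT)/eqP.
by rewrite mxE -expr2 sqr_ge0.
Qed.

Lemma row_free_gram_unit (r n : nat) (A : 'M[R]_(r, n)) :
  row_free A -> A *m A^T \in unitmx.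
Proof.
move=> fA; rewrite -row_free_unit -kermx_eq0.
set Z := kermx _; have ZAA : Z *m (A *m A^T) = 0 by apply: mulmx_ker.
have ZA0 : Z *m A = 0.
  by apply: gram_eq0; rewrite trmx_mul mulmxA -(mulmxA Z) ZAA mul0mx.
by rewrite -(mulmxKp fA Z) ZA0 mul0mx.
Qed.

Lemma penrose_ex (m n : nat) (M : 'M[R]_(m, n)) : exists X, penrose M X.
Proof.
have [r [C [B [MCB fB fC]]]] : exists r (C : 'M[R]_(m, r)) (B : 'M[R]_(r, n)),
    [/\ M = C *m B, row_free B & row_free (C^T)].
  exists (\rank M), (col_base M), (row_base M); split.
  - by rewrite mulmx_base.
  - exact: row_base_free.
  - by rewrite /row_free mxrank_tr -[_ == _]/(row_full _) col_base_full.
have uB : B *m B^T \in unitmx by apply: row_free_gram_unit.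
have uC : C^T *m C \in unitmx.
  by rewrite -{2}(trmxK C); apply: row_free_gram_unit.
pose G := invmx (B *m B^T); pose H := invmx (C^T *m C).
pose L := H *m C^T; pose D := B^T *m G.
have LC : L *m C = 1%:M by rewrite /L -mulmxA mulVmx.
have BD : B *m D = 1%:M by rewrite /D mulmxA mulmxV.
have sG : G^T = G by rewrite /G trmx_inv trmx_mul trmxK.
have sH : H^T = H by rewrite /H trmx_inv trmx_mul trmxK.
have MX : M *m (D *m L) = C *m L by rewrite MCB mulmxA -(mulmxA C) BD mulmx1.
have XM : D *m L *m M = D *m B by rewrite MCB mulmxA -(mulmxA D) LC mulmx1.
exists (D *m L); split.
- by rewrite MX MCB mulmxA -(mulmxA C L) LC mulmx1.
- by rewrite XM mulmxA -(mulmxA D B) BD mulmx1.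
- by rewrite MX /L !trmx_mul trmxK sH mulmxA.
- by rewrite XM /D !trmx_mul trmxK sG mulmxA.
Qed.

Lemma penrose_mp_pinv (m n : nat) (M : 'M[R]_(m, n)) : penrose M (mp_pinv M).
Proof. by have [X MX] := penrose_ex M; rewrite /mp_pinv; apply: xgetI MX. Qed.

End MoorePenrose.

(* The real eigenvalues of S, listed in nonincreasing order and repeated
   according to their algebraic multiplicity (rootsR is increasing). *)
Definition real_eigenvalues (R : realType) (n : nat) (S : 'M[R]_n) : seq R :=
  flatten [seq nseq (mup x (char_poly S)) x | x <- rev (rootsR (char_poly S))].

(* k counts from 1, and the value is 0 when k exceeds the number of columns. *)
Definition singular_value (R : realType) (m n : nat) (M : 'M[R]_(m, n))
    (k : nat) : R :=
  Num.sqrt (nth 0 (real_eigenvalues (M^T *m M)) k.-1).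

Definition full_rank (R : realType) (m n : nat) (M : 'M[R]_(m, n)) : bool :=
  \rank M == minn m n.

Definition condition_number (R : realType) (m n : nat) (M : 'M[R]_(m, n)) : R :=
  spectral_norm M * spectral_norm (mp_pinv M).

Definition ill_conditioned (R : realType) (threshold : R) (m n : nat)
    (M : 'M[R]_(m, n)) : bool := threshold < condition_number M.

(* Independence of a finite family: the product rule for its subfamilies is
   obtained by taking some of the B i equal to setT. *)
Definition mutually_independent (R : realType) (d : measure_display)
    (T : measurableType d) (P : probability T R) (I : finType)
    (X : I -> {RV P >-> R}) : Prop :=
  forall B : I -> set R, (forall i, measurable (B i)) ->
    P (\bigcap_(i in [set: I]) (X i @^-1` B i)) =
    (\prod_(i : I) P (X i @^-1` B i))%E.

Definition gaussian_mx (R : realType) (d : measure_display)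
    (T : measurableType d) (P : probability T R) (m n : nat)
    (X : 'M[{RV P >-> R}]_(m, n)) : Prop :=
  (forall i j (B : set R), measurable B ->
     distribution P (X i j) B = normal_prob 0 1 B) /\
  mutually_independent (fun ij : 'I_m * 'I_n => X ij.1 ij.2).

Definition sample_mx (R : realType) (d : measure_display)
    (T : measurableType d) (P : probability T R) (m n : nat)
    (X : 'M[{RV P >-> R}]_(m, n)) (w : T) : 'M[R]_(m, n) :=
  map_mx (fun f : {RV P >-> R} => f w) X.

(* Main.v *)
Require Import Defs.
From HB Require Import structures.
From mathcomp Require Import all_boot all_order all_algebra.
From mathcomp Require Import all_classical all_reals all_analysis.
From mathcomp Require Import measurable_realfun polyrcf ring lra.

Set Implicit Arguments.
Unset Strict Implicit.
Unset Printing Implicit Defensive.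

Import Order.TTheory GRing.Theory Num.Theory.
Import numFieldNormedType.Exports.

Local Open Scope classical_set_scope.
Local Open Scope ring_scope.

(** The bound on the norm of K is the triangle inequality for a row of blocks
    followed by submultiplicativity.  When q + rho < m, the matrix K factors
    through a space of dimension q + rho, so it is rank deficient for every
    outcome.  A positive l-th singular value forces U to have rank l
    ([rank_ge_singular_value]), because the kernel of U already contributes
    q - rank U zeros to the characteristic polynomial of U^T U.

    The estimates of the pseudo-inverse rest on one remark
    ([spectral_norm_mp_pinv_le]): if K Z = 1 then K^+ = (K^+ K) Z and K^+ K is
    an orthogonal projection, so the norm of K^+ is at most that of any right
    inverse Z; and the existence of Z is full rank.  If q >= m, then U^+ padded
    with zero rows is a right inverse ([mp_pinv_extend_row_free]).

    If q < m, take an orthogonal Q such that Q U has zero rows below its first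
    q ones.  Writing F and G for the upper and lower parts of Q Ubar, and H for
    Vbar^T,
        Q K = | R  F H |
              | 0  G H |
    with R invertible, and back substitution with G^+ and H^+ gives a right
    inverse whose norm is bounded by the product of the norms of its three
    factors ([mp_pinv_extend_low_rank]).

    The probabilistic content is twofold.  First, Q Ubar must again be Gaussian
    ([gaussian_triangular]).  Triangularization by Givens rotations reduces
    this to rotating two coordinates of an independent standard normal family
    ([gaussian_family_rotate]), that is, to the invariance of the planar normal
    law under rotations ([normal2_rotation]); a rotation is a product of three
    shears, and shears preserve planar Lebesgue integrals by Tonelli and
    translation invariance.  Secondly, G and H must have full rank almost
    surely ([ae_row_free_gaussian]): the determinant of a square Gaussian
    matrix is an affine function of its first entry, whose coefficients only
    depend on the other entries, hence are independent of it; its slope is a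
    smaller Gaussian determinant, nonzero by induction, and a normal law does
    not charge the single root ([ae_affine_neq0]). *)

(** * Euclidean norm, spectral norm and pseudo-inverse *)

Section Norm.
Variable R : realType.
Implicit Types m n p : nat.

Definition dotmx n (x y : 'cV[R]_n) : R := \sum_(i < n) x i 0 * y i 0.

Lemma dotmxE n (x y : 'cV[R]_n) : dotmx x y = (x^T *m y) 0 0.
Proof. by rewrite mxE; apply: eq_bigr => i _; rewrite mxE. Qed.

Lemma l2norm_ge0 n (x : 'cV[R]_n) : 0 <= l2norm x.
Proof. exact: sqrtr_ge0. Qed.

Lemma sqr_l2norm n (x : 'cV[R]_n) : l2norm x ^+ 2 = dotmx x x.
Proof.
rewrite sqr_sqrtr; last by apply: sumr_ge0 => i _; exact: sqr_ge0.
by apply: eq_bigr => i _; rewrite expr2.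
Qed.

Lemma l2norm_mulmx_dot m n (M N : 'M[R]_(m, n)) (x y : 'cV[R]_n) :
  dotmx (M *m x) (N *m y) = dotmx x (M^T *m N *m y).
Proof. by rewrite !dotmxE trmx_mul !mulmxA. Qed.

Lemma l2norm_eq0 n (x : 'cV[R]_n) : l2norm x = 0 -> x = 0.
Proof.
move=> x0; apply/colP => i; rewrite mxE.
have /eqP := sqr_l2norm x; rewrite x0 expr0n/= eq_sym psumr_eq0 => [/allP|j _].
  by move=> /(_ i); rewrite mem_index_enum -expr2 sqrf_eq0 => /(_ isT)/eqP.
by rewrite -expr2 sqr_ge0.
Qed.

Lemma l2norm0 n : l2norm (0 : 'cV[R]_n) = 0.
Proof. by rewrite /l2norm big1 ?sqrtr0// => i _; rewrite mxE expr0n. Qed.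

Lemma l2normZ n (a : R) (x : 'cV[R]_n) : l2norm (a *: x) = `|a| * l2norm x.
Proof.
rewrite /l2norm -sqrtr_sqr -sqrtrM ?sqr_ge0// mulr_sumr.
by congr Num.sqrt; apply: eq_bigr => i _; rewrite mxE exprMn.
Qed.

Lemma dotmx_linr n (a b : R) (x y z : 'cV[R]_n) :
  dotmx z (a *: x + b *: y) = a * dotmx z x + b * dotmx z y.
Proof.
rewrite /dotmx !mulr_sumr -big_split/=; apply: eq_bigr => i _.
by rewrite !mxE; ring.
Qed.

Lemma dotmxC n (x y : 'cV[R]_n) : dotmx x y = dotmx y x.
Proof. by apply: eq_bigr => i _; rewrite mulrC. Qed.

Lemma cauchy_schwarz n (x y : 'cV[R]_n) : dotmx x y <= l2norm x * l2norm y.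
Proof.
have [->|y0] := eqVneq y 0.
  by rewrite l2norm0 mulr0 /dotmx big1// => i _; rewrite mxE mulr0.
have b0 : 0 < dotmx y y.
  rewrite -sqr_l2norm exprn_gt0// lt_neqAle l2norm_ge0 andbT eq_sym.
  by apply: contraNneq y0 => /l2norm_eq0 ->.
apply: (le_trans (ler_norm _)).
rewrite -ler_sqr ?nnegrE ?mulr_ge0 ?l2norm_ge0//.
rewrite exprMn !sqr_l2norm real_normK ?num_real//.
set a := dotmx x x; set b := dotmx y y in b0 *; set c := dotmx x y.
(* The right-hand side is the squared norm of b x - c y. *)
have : 0 <= b * (a * b - c ^+ 2).
  have := sqr_ge0 (l2norm (b *: x + (- c) *: y)); rewrite sqr_l2norm dotmx_linr.
  rewrite ![dotmx (_ + _) _]dotmxC !dotmx_linr (dotmxC y x) -/a -/b -/c.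
  by apply: etrans; congr (_ <= _); ring.
by rewrite pmulr_rge0// subr_ge0.
Qed.

Lemma ler_l2normD n (x y : 'cV[R]_n) : l2norm (x + y) <= l2norm x + l2norm y.
Proof.
rewrite -ler_sqr ?nnegrE ?addr_ge0 ?l2norm_ge0// sqrrD !sqr_l2norm.
rewrite -[x]scale1r -[y]scale1r dotmx_linr ![dotmx (_ + _) _]dotmxC !dotmx_linr.
rewrite !scale1r (dotmxC y x); have := cauchy_schwarz x y; lra.
Qed.

Lemma sqr_l2norm_col m n (x : 'cV[R]_m) (y : 'cV[R]_n) :
  l2norm (col_mx x y) ^+ 2 = l2norm x ^+ 2 + l2norm y ^+ 2.
Proof.
rewrite !sqr_l2norm /dotmx big_split_ord/=.
by congr (_ + _); apply: eq_bigr => i _; rewrite ?col_mxEu ?col_mxEd.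
Qed.

Lemma l2norm_col0 m n (x : 'cV[R]_m) : l2norm (col_mx x (0 : 'cV_n)) = l2norm x.
Proof.
apply/eqP; rewrite -(@eqrXn2 _ 2) ?l2norm_ge0//.
by rewrite sqr_l2norm_col l2norm0 expr0n/= addr0.
Qed.

Lemma ler_l2norm_colu m n (x : 'cV[R]_m) (y : 'cV[R]_n) :
  l2norm x <= l2norm (col_mx x y).
Proof.
by rewrite -ler_sqr ?nnegrE ?l2norm_ge0// sqr_l2norm_col lerDl sqr_ge0.
Qed.

Lemma ler_l2norm_cold m n (x : 'cV[R]_m) (y : 'cV[R]_n) :
  l2norm y <= l2norm (col_mx x y).
Proof.
by rewrite -ler_sqr ?nnegrE ?l2norm_ge0// sqr_l2norm_col lerDr sqr_ge0.
Qed.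

Lemma l2norm_isometry m n (Q : 'M[R]_(m, n)) (x : 'cV[R]_n) :
  Q^T *m Q = 1%:M -> l2norm (Q *m x) = l2norm x.
Proof.
move=> QQ; apply/eqP; rewrite -(@eqrXn2 _ 2) ?l2norm_ge0//.
by rewrite !sqr_l2norm l2norm_mulmx_dot QQ mul1mx.
Qed.

(** The image satisfies |Q x|^2 = <x, Q x>, so Cauchy-Schwarz applies. *)
Lemma l2norm_orthoproj_le n (Q : 'M[R]_n) (x : 'cV[R]_n) :
  Q^T = Q -> Q *m Q = Q -> l2norm (Q *m x) <= l2norm x.
Proof.
move=> sQ QQ; have [->|y0] := eqVneq (Q *m x) 0; first by rewrite l2norm0 l2norm_ge0.
have b0 : 0 < l2norm (Q *m x).
  rewrite lt_neqAle l2norm_ge0 andbT eq_sym.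
  by apply: contraNneq y0 => /l2norm_eq0 ->.
rewrite -(ler_pM2r b0) -expr2 sqr_l2norm l2norm_mulmx_dot sQ QQ.
exact: cauchy_schwarz.
Qed.

(** The Frobenius norm is a witness.  This makes the set whose supremum is the
    spectral norm bounded, so that the supremum is meaningful. *)
Lemma l2norm_mulmx_bounded m n (M : 'M[R]_(m, n)) :
  exists2 C, 0 <= C & forall x : 'cV[R]_n, l2norm (M *m x) <= C * l2norm x.
Proof.
exists (Num.sqrt (\sum_i \sum_j M i j ^+ 2)); first exact: sqrtr_ge0.
have S0 i : 0 <= \sum_j M i j ^+ 2 by apply: sumr_ge0 => j _; exact: sqr_ge0.
move=> x; rewrite -ler_sqr ?nnegrE ?mulr_ge0 ?sqrtr_ge0 ?l2norm_ge0// exprMn.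
rewrite (sqr_l2norm (M *m x)) sqr_sqrtr; last by apply: sumr_ge0 => i _; exact: S0.
rewrite mulr_suml; apply: ler_sum => i _.
have -> : (M *m x) i 0 = dotmx (row i M)^T x.
  by rewrite mxE; apply: eq_bigr => j _; rewrite !mxE.
have -> : \sum_j M i j ^+ 2 = l2norm (row i M)^T ^+ 2.
  rewrite sqr_l2norm; apply: eq_bigr => j _; by rewrite !mxE expr2.
rewrite -expr2 -exprMn -real_normK ?num_real//.
rewrite ler_sqr ?nnegrE ?normr_ge0 ?mulr_ge0 ?l2norm_ge0// ler_norml.
rewrite cauchy_schwarz andbT lerNl.
have := cauchy_schwarz (- (row i M)^T) x.
rewrite -scaleN1r l2normZ normrN1 mul1r; apply: etrans; congr (_ <= _).
rewrite [RHS]dotmxC -[X in dotmx x X]addr0 -[X in _ + X](scale0r 0) dotmx_linr.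
by rewrite mulN1r mul0r addr0 dotmxC.
Qed.

Lemma spectral_norm_has_sup m n (M : 'M[R]_(m, n)) :
  has_sup [set l2norm (M *m x) | x in [set x : 'cV[R]_n | l2norm x <= 1]].
Proof.
split; first by exists (l2norm (M *m 0)); exists 0 => //=; rewrite l2norm0 ler01.
have [C C0 MC] := l2norm_mulmx_bounded M; exists C => _ [x /= x1 <-].
by apply: (le_trans (MC x)); rewrite ler_piMr.
Qed.

Lemma spectral_norm_ge0 m n (M : 'M[R]_(m, n)) : 0 <= spectral_norm M.
Proof.
apply: le_trans (l2norm_ge0 (M *m 0)) _.
apply: ub_le_sup; first by case: (spectral_norm_has_sup M).
by exists 0 => //=; rewrite l2norm0 ler01.
Qed.

Lemma l2norm_mulmx m n (M : 'M[R]_(m, n)) (x : 'cV[R]_n) :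
  l2norm (M *m x) <= spectral_norm M * l2norm x.
Proof.
have [->|x0] := eqVneq x 0; first by rewrite mulmx0 !l2norm0 mulr0.
have b0 : 0 < l2norm x.
  rewrite lt_neqAle l2norm_ge0 andbT eq_sym.
  by apply: contraNneq x0 => /l2norm_eq0 ->.
have {1}-> : x = l2norm x *: ((l2norm x)^-1 *: x).
  by rewrite scalerA mulfV ?gt_eqF// scale1r.
rewrite -scalemxAr (l2normZ (l2norm x) (M *m _)) ger0_norm ?l2norm_ge0// mulrC.
rewrite ler_wpM2r ?l2norm_ge0//.
apply: ub_le_sup; first by case: (spectral_norm_has_sup M).
exists ((l2norm x)^-1 *: x) => //=.
by rewrite l2normZ ger0_norm ?invr_ge0 ?l2norm_ge0// mulVf ?gt_eqF.
Qed.

Lemma spectral_norm_le m n (M : 'M[R]_(m, n)) (c : R) : 0 <= c ->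
  (forall x : 'cV[R]_n, l2norm (M *m x) <= c * l2norm x) -> spectral_norm M <= c.
Proof.
move=> c0 Mc; apply: ge_sup; first by case: (spectral_norm_has_sup M).
by move=> _ [x /= x1 <-]; apply: (le_trans (Mc x)); rewrite ler_piMr.
Qed.

Lemma spectral_normM m n p (M : 'M[R]_(m, n)) (N : 'M[R]_(n, p)) :
  spectral_norm (M *m N) <= spectral_norm M * spectral_norm N.
Proof.
apply: spectral_norm_le => [|x]; first by rewrite mulr_ge0 ?spectral_norm_ge0.
rewrite -mulmxA; apply: (le_trans (l2norm_mulmx _ _)).
by rewrite -mulrA ler_wpM2l ?spectral_norm_ge0// l2norm_mulmx.
Qed.

Lemma spectral_norm_row_mx m n p (M : 'M[R]_(m, n)) (N : 'M[R]_(m, p)) :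
  spectral_norm (row_mx M N) <= spectral_norm M + spectral_norm N.
Proof.
apply: spectral_norm_le => [|x]; first by rewrite addr_ge0 ?spectral_norm_ge0.
rewrite -[x]vsubmxK mul_row_col; apply: (le_trans (ler_l2normD _ _)).
rewrite mulrDl; apply: lerD; apply: (le_trans (l2norm_mulmx _ _)).
  by rewrite ler_wpM2l ?spectral_norm_ge0// ler_l2norm_colu.
by rewrite ler_wpM2l ?spectral_norm_ge0// ler_l2norm_cold.
Qed.

Lemma mulmx_mp_pinv m n (M : 'M[R]_(m, n)) : row_free M -> M *m mp_pinv M = 1%:M.
Proof.
move=> fM; have [MX _ _ _] := penrose_mp_pinv M.
by apply: (row_free_inj fM); rewrite MX mul1mx.
Qed.

(** Take norms in M = M M^+ M. *)
Lemma spectral_norm_mp_pinv_ge m n (M : 'M[R]_(m, n)) :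
  0 < spectral_norm M -> 1 <= spectral_norm M * spectral_norm (mp_pinv M).
Proof.
move=> M0; have [MX _ _ _] := penrose_mp_pinv M.
rewrite -(ler_pM2r M0) mul1r -{1}MX.
apply: (le_trans (spectral_normM _ _)).
by rewrite ler_wpM2r ?spectral_norm_ge0// spectral_normM.
Qed.

(** The pseudo-inverse is optimal among right inverses: K^+ = (K^+ K) Z, and
    K^+ K is an orthogonal projection. *)
Lemma spectral_norm_mp_pinv_le m n (K : 'M[R]_(m, n)) (Z : 'M[R]_(n, m)) (c : R) :
  0 <= c -> K *m Z = 1%:M ->
  (forall y : 'cV[R]_m, l2norm (Z *m y) <= c * l2norm y) ->
  spectral_norm (mp_pinv K) <= c.
Proof.
move=> c0 KZ Zc; have [KX XK sKX sXK] := penrose_mp_pinv K.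
have -> : mp_pinv K = (mp_pinv K *m K) *m Z by rewrite -mulmxA KZ mulmx1.
apply: spectral_norm_le => // y; apply: le_trans (Zc y).
by rewrite -mulmxA; apply: l2norm_orthoproj_le => //; rewrite mulmxA XK.
Qed.

Lemma mulmx1_full_rank m n (K : 'M[R]_(m, n)) (Z : 'M[R]_(n, m)) :
  K *m Z = 1%:M -> full_rank K.
Proof.
move=> KZ; rewrite /full_rank; suff rK : \rank K = m.
  by rewrite rK; apply/eqP/esym/minn_idPl; rewrite -{1}rK rank_leq_col.
apply/eqP; rewrite eqn_leq rank_leq_row -{1}(mxrank1 R m) -KZ.
exact: mxrankM_maxl.
Qed.

(** U^+ padded with zero rows is a right inverse of (U | A). *)
Lemma mp_pinv_extend_row_free m n q (U : 'M[R]_(m, q)) (A : 'M[R]_(m, n)) :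
  row_free U -> full_rank (row_mx U A) /\
  spectral_norm (mp_pinv (row_mx U A)) <= spectral_norm (mp_pinv U).
Proof.
move=> fU; have KZ : row_mx U A *m col_mx (mp_pinv U) 0 = 1%:M.
  by rewrite mul_row_col mulmx0 addr0 mulmx_mp_pinv.
split; first exact: mulmx1_full_rank KZ.
apply: spectral_norm_mp_pinv_le KZ _ => [|y]; first exact: spectral_norm_ge0.
by rewrite mul_col_mx mul0mx l2norm_col0 l2norm_mulmx.
Qed.

(** With R the upper block of Q U, the matrix Q (U | X H) is upper block
    triangular with diagonal blocks R and G H.  Inverting it from the right
    amounts to applying in turn diag(1, H^+ G^+), the unipotent matrix with
    off-diagonal block - F H, and diag(R^-1, 1); these three matrices
    contribute the maximum, the factor 1 + |F| |H| and the factor |U^+|; for the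
    last one, |U| = 1 is used to know that |U^+| is at least 1.  R^-1 is
    replaced by U^+ Q^T, which agrees with it on vectors supported on the first
    q coordinates. *)
Lemma mp_pinv_extend_low_rank q p n r (U : 'M[R]_(q + p, q)) (X : 'M[R]_(q + p, r))
    (H : 'M[R]_(r, n)) (Q : 'M[R]_(q + p)) :
  let F := usubmx (Q *m X) in let G := dsubmx (Q *m X) in
  spectral_norm U = 1 -> \rank U = q -> Q^T *m Q = 1%:M ->
  dsubmx (Q *m U) = 0 -> row_free G -> row_free H ->
  full_rank (row_mx U (X *m H)) /\
  spectral_norm (mp_pinv (row_mx U (X *m H))) <=
    spectral_norm (mp_pinv U)
    * Num.max 1 (spectral_norm (mp_pinv G) * spectral_norm (mp_pinv H))
    * (1 + spectral_norm F * spectral_norm H).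
Proof.
move=> F G nU rU QQ QU0 fG fH.
have QQ' : Q *m Q^T = 1%:M by apply: mulmx1C.
set u := spectral_norm (mp_pinv U).
set gh := spectral_norm (mp_pinv G) * _; set fh := spectral_norm F * _.
have u1 : 1 <= u.
  by have := spectral_norm_mp_pinv_ge (M := U); rewrite nU mul1r; apply.
have u0 : 0 <= u by apply: le_trans u1.
have gh0 : 0 <= gh by rewrite mulr_ge0 ?spectral_norm_ge0.
have fh0 : 0 <= fh by rewrite mulr_ge0 ?spectral_norm_ge0.
pose R1 := usubmx (Q *m U).
have QUE : Q *m U = col_mx R1 0 by rewrite -[LHS]vsubmxK QU0.
have R1u : R1 \in unitmx.
  rewrite -row_free_unit /row_free eqn_leq rank_leq_row -{1}rU.
  have -> : U = Q^T *m col_mx 1%:M 0 *m R1.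
    by rewrite -mulmxA mul_col_mx mul1mx mul0mx -QUE mulmxA QQ mul1mx.
  exact: mxrankM_maxr.
pose E1 := usubmx Q; pose E2 := dsubmx Q.
pose X2 := mp_pinv H *m mp_pinv G *m E2.
pose W := E1 - F *m H *m X2.
pose X1 := mp_pinv U *m Q^T *m col_mx W 0.
have UX1 : Q *m (U *m X1) = col_mx W 0.
  have QW : Q^T *m col_mx W 0 = U *m (invmx R1 *m W).
    rewrite -[U in RHS]mul1mx -QQ -!mulmxA; congr (_ *m _).
    by rewrite mulmxA QUE mul_col_mx mul0mx mulmxA mulmxV// mul1mx.
  have [UX _ _ _] := penrose_mp_pinv U.
  rewrite /X1 -!mulmxA QW (mulmxA (mp_pinv U)) (mulmxA U) (mulmxA U (mp_pinv U)).
  by rewrite UX -QW mulmxA QQ' mul1mx.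
have KZ : row_mx U (X *m H) *m col_mx X1 X2 = 1%:M.
  rewrite mul_row_col -[LHS]mul1mx -QQ -mulmxA mulmxDr UX1.
  rewrite -(mulmxA X H X2) (mulmxA Q X) -[Q *m X]vsubmxK -/F -/G.
  rewrite mul_col_mx add_col_mx /W -(mulmxA F) subrK add0r.
  rewrite /X2 !mulmxA -(mulmxA G H) mulmx_mp_pinv// mulmx1 mulmx_mp_pinv//.
  by rewrite mul1mx vsubmxK.
split; first exact: mulmx1_full_rank KZ.
apply: spectral_norm_mp_pinv_le KZ _ => [|y].
  by rewrite !mulr_ge0// ?addr_ge0// le_max ler01.
set M := Num.max _ _.
have M1 : 1 <= M by rewrite le_max lexx.
have Mgh : gh <= M by rewrite le_max lexx orbT.
have M0 : 0 <= M by apply: le_trans M1.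
pose y1 := E1 *m y; pose y2 := E2 *m y; pose x2 := X2 *m y.
have ny : l2norm (col_mx y1 y2) = l2norm y.
  by rewrite -mul_col_mx vsubmxK l2norm_isometry.
have nx2 : l2norm x2 <= M * l2norm y2.
  apply: (@le_trans _ _ (gh * l2norm y2)); last by rewrite ler_wpM2r ?l2norm_ge0.
  rewrite /x2 /X2 -!mulmxA; apply: (le_trans (l2norm_mulmx _ _)).
  rewrite /gh [_ * spectral_norm (mp_pinv H)]mulrC -mulrA.
  by rewrite ler_wpM2l ?spectral_norm_ge0// l2norm_mulmx.
have nyx : l2norm (col_mx y1 x2) <= M * l2norm y.
  rewrite -ny -ler_sqr ?nnegrE ?mulr_ge0 ?l2norm_ge0// exprMn !sqr_l2norm_col.
  rewrite mulrDr; apply: lerD; first by rewrite ler_peMl ?sqr_ge0// exprn_ege1.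
  by rewrite -exprMn ler_sqr ?nnegrE ?mulr_ge0 ?l2norm_ge0.
have nwx : l2norm (col_mx (W *m y) x2) <= (1 + fh) * l2norm (col_mx y1 x2).
  have -> : col_mx (W *m y) x2 =
      col_mx y1 x2 + (-1) *: col_mx (F *m H *m x2) (0 : 'cV_n).
    rewrite scale_col_mx scaler0 add_col_mx addr0 scaleN1r /W mulmxBl.
    by rewrite /x2 -!mulmxA.
  apply: (le_trans (ler_l2normD _ _)).
  rewrite l2normZ normrN1 mul1r l2norm_col0 mulrDl mul1r lerD2l.
  apply: (le_trans (l2norm_mulmx _ _)); apply: ler_pM;
    rewrite ?spectral_norm_ge0 ?l2norm_ge0//.
    exact: spectral_normM.
  exact: ler_l2norm_cold.
apply: (@le_trans _ _ (u * l2norm (col_mx (W *m y) x2))); last first.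
  rewrite -!mulrA ler_wpM2l// (le_trans nwx)// mulrCA ler_wpM2l ?addr_ge0//.
rewrite mul_col_mx -ler_sqr ?nnegrE ?mulr_ge0 ?l2norm_ge0//.
rewrite exprMn !sqr_l2norm_col mulrDr; apply: lerD; last first.
  by rewrite ler_peMl ?sqr_ge0// exprn_ege1.
rewrite -exprMn ler_sqr ?nnegrE ?mulr_ge0 ?l2norm_ge0//.
rewrite /X1 -!mulmxA; apply: (le_trans (l2norm_mulmx _ _)).
rewrite ler_wpM2l// l2norm_isometry ?trmxK//.
by rewrite mul_col_mx mul0mx l2norm_col0.
Qed.
End Norm.

(** * Rank and singular values *)

Section NumericalRank.
Variable R : realType.

(** Sylvester's identity: multiplying the block matrix | X C ; B 1 | on the
    right by two block triangular matrices computes its determinant twice. *)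
Lemma char_poly_mulC (n r : nat) (C : 'M[R]_(n, r)) (B : 'M[R]_(r, n)) :
  char_poly (C *m B) * 'X^r = 'X^n * char_poly (B *m C).
Proof.
pose c := map_mx polyC C; pose b := map_mx polyC B.
pose M : 'M[{poly R}]_(n + r) := block_mx ('X%:M) c b 1%:M.
have M1 : \det M = char_poly (C *m B).
  have : \det (M *m block_mx 1%:M 0 (- b) 1%:M) = char_poly (C *m B).
    rewrite mulmx_block !mulmx1 !mulmx0 !mul1mx !add0r subrr det_ublock det1 mulr1.
    by rewrite mulmxN -map_mxM.
  by rewrite det_mulmx det_lblock !det1 !mulr1.
rewrite -M1 -det_scalar -(det_scalar n 'X).
have : \det (M *m block_mx 1%:M (- c) 0 'X%:M) = 
    \det ('X%:M : 'M[{poly R}]_n) * char_poly (B *m C).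
  rewrite mulmx_block !mulmx1 !mulmx0 !mul1mx !addr0.
  rewrite mul_mx_scalar mul_scalar_mx scalerN addNr det_lblock.
  by rewrite mulmxN -map_mxM addrC.
by rewrite det_mulmx det_ublock det1 mul1r.
Qed.

(** Factor U through its rank r: up to powers of X, the polynomial is that of
    an r x r matrix. *)
Lemma mup0_char_poly_gram (m q : nat) (U : 'M[R]_(m, q)) :
  (q - \rank U <= mup 0 (char_poly (U^T *m U)))%N.
Proof.
have rq : (\rank U <= q)%N by exact: rank_leq_col.
rewrite mup_geq ?monic_neq0 ?char_poly_monic// subr0.
have := char_poly_mulC (U^T *m col_base U) (row_base U).
rewrite -mulmxA mulmx_base.
rewrite [X in X * char_poly (row_base U *m _)](_ : _ =
  'X^(q - \rank U) * 'X^(\rank U)); last by rewrite -exprD subnK.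
rewrite -mulrA ['X^(\rank U) * _]mulrC mulrA.
move=> /(mulIf (monic_neq0 (monicXn _ _))) ->.
by rewrite dvdp_mulr.
Qed.

Lemma dvdp_prod_mup (p : {poly R}) (s : seq R) : p != 0 -> uniq s ->
  \prod_(x <- s) ('X - x%:P) ^+ mup x p %| p.
Proof.
move=> p0; elim: s => [_|x s IH /= /andP[xs us]]; first by rewrite big_nil dvd1p.
rewrite big_cons Gauss_dvdp ?IH// -?mup_geq ?leqnn//.
rewrite coprimep_expl// coprimep_sym coprimep_XsubC.
rewrite /root horner_prod prodf_seq_neq0; apply/allP => y ys /=.
rewrite hornerE hornerXsubC expf_neq0// subr_eq0.
by apply: contraNneq xs => ->.
Qed.

(** The product of the (X - x)^(mup x p) divides p; the inequality is strict
    because the size of a polynomial is its degree plus one. *)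
Lemma sum_mup_le (p : {poly R}) (s : seq R) : p != 0 -> uniq s ->
  (\sum_(x <- s) mup x p < size p)%N.
Proof.
move=> p0 us; apply: leq_trans (dvdp_leq p0 (dvdp_prod_mup p0 us)).
have -> : \prod_(x <- s) ('X - x%:P) ^+ mup x p =
    \prod_(x <- flatten [seq nseq (mup x p) x | x <- s]) ('X - x%:P).
  rewrite big_flatten big_map; apply: eq_bigr => x _.
  by rewrite big_nseq iter_mulr_1.
rewrite size_prod_XsubC size_flatten /shape -map_comp sumnE big_map.
rewrite ltnS leq_eqVlt (eq_bigr (fun x => mup x p)) ?eqxx// => x _.
by rewrite /= size_nseq.
Qed.

Lemma sorted_sign_split (s : seq R) : sorted <%R s ->
  s = [seq x <- s | x <= 0] ++ [seq x <- s | 0 < x].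
Proof.
elim: s => // x s IH /=; rewrite (path_sortedE lt_trans) => /andP[xs /IH ss].
case: ltP => x0 /=; last by rewrite {1}ss.
have s0 : all (fun y => 0 < y) s.
  by apply/allP => y /(allP xs); apply: lt_trans.
have /all_filterP -> := s0.
suff -> : [seq y <- s | y <= 0] = [::] by [].
apply/eqP; rewrite -(negbK (_ == _)) -has_filter; apply/hasPn => y /(allP s0).
by rewrite ltNge.
Qed.

(** If the k-th eigenvalue is positive, then the positive eigenvalues, counted
    with multiplicity, are at least k; together with the q - rank U zeros they
    cannot exceed the degree q of the characteristic polynomial. *)
Lemma rank_ge_singular_value (m q : nat) (U : 'M[R]_(m, q)) (k : nat) :
  (0 < k)%N -> 0 < singular_value U k -> (k <= \rank U)%N.
Proof.
move=> k0; rewrite /singular_value sqrtr_gt0 /real_eigenvalues.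
set p := char_poly _.
have p0 : p != 0 by rewrite monic_neq0 ?char_poly_monic.
set s := rootsR p; have ss : sorted <%R s := sorted_roots _ _ _.
pose e (t : seq R) := flatten [seq nseq (mup x p) x | x <- t].
have me (t : seq R) y : y \in e t -> y \in t.
  move=> /flattenP[z /mapP[x xt ->]]; rewrite mem_nseq => /andP[_ /eqP ->] //.
pose s1 := [seq x <- s | 0 < x]; pose s2 := [seq x <- s | x <= 0].
have -> : flatten [seq nseq (mup x p) x | x <- rev s] = e (rev s1) ++ e (rev s2).
  by rewrite {1}(sorted_sign_split ss) rev_cat map_cat flatten_cat.
rewrite nth_cat; case: ltnP => [ks _|_]; last first.
  have [ks|ks] := ltnP (k.-1 - size (e (rev s1))) (size (e (rev s2))); last first.
    by rewrite nth_default// ltxx.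
  have /me := mem_nth 0 ks; rewrite mem_rev mem_filter => /andP[+ _].
  by rewrite leNgt => /negPf ->.
have ke : (k <= \sum_(x <- s1) mup x p)%N.
  move: ks; rewrite prednK// /e size_flatten /shape -map_comp sumnE big_map.
  rewrite (eq_bigr (fun x => mup x p)) => [|x _]; last by rewrite /= size_nseq.
  by rewrite (perm_big s1) ?perm_rev// perm_sym perm_rev.
(* Counting 0 along with the positive roots brings in the kernel of U. *)
have := @sum_mup_le p (0 :: s1) p0; rewrite big_cons size_char_poly ltnS.
rewrite /= mem_filter ltxx/= filter_uniq ?(sorted_uniq lt_trans ltxx)//.
move=> /(_ isT) H.
have := mup0_char_poly_gram U; rewrite -/p => H0.
have rq : (\rank U <= q)%N by exact: rank_leq_col.
rewrite -(leq_add2l (q - \rank U)) subnK//.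
exact: leq_trans (leq_add H0 ke) H.
Qed.
End NumericalRank.

(** * Rotation invariance of the planar normal law *)

Section Lebesgue.
Variable R : realType.
Local Notation mu := (@lebesgue_measure R).
Local Open Scope ereal_scope.

Lemma lebesgue_measure_translate (a : R) (A : set R) : measurable A ->
  pushforward mu
    (fun x : measurableTypeR R => (x + a)%R : measurableTypeR R) A = mu A.
Proof.
have mphi : measurable_fun setT
    (fun x : measurableTypeR R => (x + a)%R : measurableTypeR R).
  exact: measurable_funD.
move=> mA; apply/esym/lebesgue_measure_unique => //= _ [[b c]] _ <-.
rewrite /pushforward/=.
have -> : (fun x : R => x + a)%R @^-1` `]b, c] = `](b - a)%R, (c - a)%R]%classic.
  by apply/seteqP; split => x /=; rewrite !in_itv/= ltrBlDr lerBrDr.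
rewrite !lebesgue_measure_itv/= !lte_fin ltrD2r; case: ifP => // _.
by rewrite -!EFinB; congr (_%:E); ring.
Qed.

Lemma ge0_integral_translate (a : R) (f : R -> \bar R) :
  measurable_fun setT f -> (forall x, 0 <= f x) ->
  \int[mu]_x f (x + a)%R = \int[mu]_x f x.
Proof.
move=> mf f0.
pose phi := (fun x : measurableTypeR R => (x + a)%R : measurableTypeR R).
have mphi : measurable_fun setT phi by exact: measurable_funD.
have -> : \int[mu]_x f (x + a)%R = \int[pushforward mu phi]_x f x.
  by rewrite (ge0_integral_pushforward mphi mu measurableT mf)//.
by apply: eq_measure_integral => //= A mA _; exact: lebesgue_measure_translate.
Qed.

Let R2 := (measurableTypeR R * measurableTypeR R)%type.

Lemma integral_shear_snd (t : R) (g : R2 -> \bar R) :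
  measurable_fun setT g -> (forall z, 0 <= g z) ->
  \int[mu]_x \int[mu]_y g (x, y + t * x)%R = \int[mu]_x \int[mu]_y g (x, y).
Proof.
move=> mg g0; apply: eq_integral => x _.
apply: (ge0_integral_translate _ (f := fun y => g (x, y))) => //.
exact: measurableT_comp.
Qed.

(** Same as for the other shear, after exchanging the two integrals. *)
Lemma integral_shear_fst (t : R) (g : R2 -> \bar R) :
  measurable_fun setT g -> (forall z, 0 <= g z) ->
  \int[mu]_x \int[mu]_y g (x + t * y, y)%R = \int[mu]_x \int[mu]_y g (x, y).
Proof.
move=> mg g0.
have := @fubini_tonelli _ _ _ _ _ mu mu g mg g0; rewrite /fubini_F /fubini_G => ->.
have mg' : measurable_fun setT (fun z : R2 => g (z.1 + t * z.2, z.2)%R).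
  apply: measurableT_comp => //; apply: measurable_fun_pair => //.
  by apply: measurable_funD => //; apply: measurable_funM.
have := @fubini_tonelli _ _ _ _ _ mu mu _ mg' (fun z => g0 _).
rewrite /fubini_F /fubini_G /= => ->.
apply: eq_integral => y _.
apply: (ge0_integral_translate _ (f := fun x => g (x, y))) => //.
exact: measurableT_comp.
Qed.

(** A rotation of sine s and cosine c, with s nonzero, is the product of three
    shears with coefficients t, - s, t where t = (1 - c) / s is the tangent of
    the half angle. *)
Lemma integral_rotation (c s : R) (g : R2 -> \bar R) : (s != 0)%R ->
  (c ^+ 2 + s ^+ 2 = 1)%R ->
  measurable_fun setT g -> (forall z, 0 <= g z) ->
  \int[mu]_x \int[mu]_y g (c * x + s * y, - s * x + c * y)%R =
  \int[mu]_x \int[mu]_y g (x, y).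
Proof.
move=> s0 cs mg g0; pose t := ((1 - c) / s)%R.
have mp (h : R2 -> R2) : measurable_fun setT h -> measurable_fun setT (g \o h).
  by move=> mh; apply: measurableT_comp.
have m1 : measurable_fun setT (fun z : R2 => (z.1 + t * z.2, z.2)%R : R2).
  apply: measurable_fun_pair => //.
  by apply: measurable_funD => //; apply: measurable_funM.
have m2 : measurable_fun setT (fun z : R2 => (z.1, z.2 + (- s) * z.1)%R : R2).
  apply: measurable_fun_pair => //.
  by apply: measurable_funD => //; apply: measurable_funM.
rewrite -(integral_shear_fst t mg g0).
rewrite -(integral_shear_snd (- s)%R (mp _ m1) (fun z => g0 _)).
rewrite -(integral_shear_fst t (mp _ (measurableT_comp m1 m2)) (fun z => g0 _)).
apply: eq_integral => x _; apply: eq_integral => y _ /=.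
have c2 : (s * t = 1 - c)%R by rewrite /t mulrC divfK.
have cs' : (c ^+ 2 = 1 - s ^+ 2)%R by rewrite -cs addrK.
have c3 : (t * (1 + c) = s)%R.
  rewrite /t mulrAC; have -> : ((1 - c) * (1 + c) = s * s)%R by ring: cs'.
  by rewrite mulfK.
have cE : (c = 1 - s * t)%R by rewrite c2 opprB addrC subrK.
have c4 : (t * (2 - s * t) = s)%R by rewrite -[RHS]c3 c2; congr (_ * _)%R; ring.
have c5 : (s * t ^+ 2 = 2 * t - s)%R by rewrite -[X in (_ - X)%R]c4; ring.
by congr (g (_, _)); rewrite cE; ring: c5.
Qed.

Local Notation gamma := (@normal_prob R 0%R 1%R).
Local Notation pdf := (@normal_pdf R 0%R 1%R).

(** The density is a Radon-Nikodym derivative of the normal law, by uniqueness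
    of the latter. *)
Lemma integral_normal_prob (f : R -> \bar R) :
  gamma.-integrable setT f ->
  \int[gamma]_x f x = \int[mu]_x (f x * (pdf x)%:E).
Proof.
move=> intf; have mf : measurable_fun setT f := measurable_int _ intf.
have dom : gamma `<< mu by exact: normal_prob_dominates.
rewrite -(Radon_Nikodym_change_of_variables dom)//=.
apply: ae_eq_integral => //.
- by apply: emeasurable_funM => //; apply: (measurable_int mu).
- apply: emeasurable_funM => //=; apply/measurableT_comp => //=.
  exact: measurable_normal_pdf.
- apply: ae_eqe_mul2l => /=; rewrite Radon_NikodymE//=.
  case: cid => /= h [h1 h2 h3].
  apply: integral_ae_eq => //=.
  + by apply/measurableT_comp => //; exact: measurable_normal_pdf.
  + by move=> E _ mE; rewrite -h3.
Qed.

Lemma normal_prob_indic (A : set R) : measurable A ->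
  gamma A = \int[mu]_y (pdf y * \1_A y)%:E.
Proof.
move=> mA; rewrite /normal_prob integral_mkcond; apply: eq_integral => x _.
by rewrite patchE indicE; case: ifPn; rewrite ?mulr1 ?mulr0.
Qed.

Lemma integrable_normal_xsection (S : set R2) : measurable S ->
  gamma.-integrable setT (fun x => gamma (xsection S x)).
Proof.
move=> mS; apply: (@le_integrable _ _ _ _ _ _ _ (cst 1)).
- by [].
- by apply: (measurable_fun_xsection gamma); exact: mS.
- move=> x _; rewrite gee0_abs ?measure_ge0// gee0_abs//.
  by apply: (@probability_le1 _ _ _ gamma); exact: measurable_xsection.
- exact: finite_measure_integrable_cst.
Qed.

(** The planar density is a function of x^2 + y^2, hence it is invariant under
    the rotation, as is Lebesgue measure. *)
Lemma normal2_rotation (c s : R) (A B : set R) : (s != 0)%R ->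
  (c ^+ 2 + s ^+ 2 = 1)%R -> measurable A -> measurable B ->
  (gamma \x gamma)
    [set z : R2 | A (c * z.1 + s * z.2)%R /\ B (- s * z.1 + c * z.2)%R]
  = gamma A * gamma B.
Proof.
move=> s0 cs mA mB.
set S := [set z : R2 | _].
have mrot : measurable_fun setT
    (fun z : R2 => (c * z.1 + s * z.2, - s * z.1 + c * z.2)%R : R2).
  by apply: measurable_fun_pair; apply: measurable_funD => //;
    apply: measurable_funM.
have mS : measurable S.
  have -> : S = (fun z : R2 => (c * z.1 + s * z.2, - s * z.1 + c * z.2)%R : R2)
      @^-1` (A `*` B) by [].
  by rewrite -[X in measurable X]setTI; apply: mrot => //; exact: measurableX.
pose g (z : R2) := (pdf z.1 * \1_A z.1 * (pdf z.2 * \1_B z.2))%:E.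
have g0 z : 0 <= g z by rewrite lee_fin !mulr_ge0// normal_pdf_ge0.
have mg : measurable_fun setT g.
  apply/measurable_EFinP; apply: measurable_funM; apply: measurable_funM.
  - by apply: measurableT_comp => //; exact: measurable_normal_pdf.
  - by apply: measurableT_comp => //; exact: measurable_indic.
  - by apply: measurableT_comp => //; exact: measurable_normal_pdf.
  - by apply: measurableT_comp => //; exact: measurable_indic.
have pdfM x y : (pdf (c * x + s * y) * pdf (- s * x + c * y) = pdf x * pdf y)%R.
  rewrite normal_pdfE ?oner_neq0// /normal_fun mulrACA [RHS]mulrACA -!expRD.
  congr (_ * expR _)%R.
  have cs' : (c ^+ 2 = 1 - s ^+ 2)%R by rewrite -cs addrK.
  by field: cs'.
transitivity (\int[mu]_x \int[mu]_y
    g (c * x + s * y, - s * x + c * y)%R).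
  rewrite /product_measure1 integral_normal_prob; last first.
    exact: integrable_normal_xsection.
  apply: eq_integral => x _.
  rewrite [X in X * _](normal_prob_indic (measurable_xsection x mS)).
  rewrite -ge0_integralZr//; last 3 first.
  - apply/measurable_EFinP; apply: measurable_funM.
      exact: measurable_normal_pdf.
    by apply: measurable_indic; exact: measurable_xsection.
  - by move=> y _; rewrite lee_fin mulr_ge0// normal_pdf_ge0.
  - by rewrite lee_fin normal_pdf_ge0.
  apply: eq_integral => y _.
  have E : \1_(xsection S x) y =
      (\1_A (c * x + s * y) * \1_B (- s * x + c * y))%R :> R.
    rewrite !indicE -natrM mulnb; congr (_%:R); congr nat_of_bool.
    apply/idP/andP; rewrite mem_xsection !inE; last by case.
    by move=> ?.
  rewrite -EFinM E /g.
  have H (p p' a b u v : R) :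
      (u * v = p * p' -> p' * (a * b) * p = u * a * (v * b))%R.
    by move=> uv; rewrite mulrACA uv; ring.
  exact: (congr1 EFin (H _ _ _ _ _ _ (pdfM x y))).
rewrite (integral_rotation s0 cs mg g0).
rewrite !normal_prob_indic//.
have mpdf (D : set R) : measurable D ->
    measurable_fun setT (fun x => (pdf x * \1_D x)%:E).
  move=> mD; apply/measurable_EFinP; apply: measurable_funM.
    exact: measurable_normal_pdf.
  exact: measurable_indic.
have pdf0 (D : set R) x : 0 <= (pdf x * \1_D x)%:E.
  by rewrite lee_fin mulr_ge0// normal_pdf_ge0.
rewrite -ge0_integralZr//; last 2 first.
- exact: mpdf.
- by apply: integral_ge0 => y _.
by apply: eq_integral => x _; rewrite -ge0_integralZl//; exact: mpdf.
Qed.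
End Lebesgue.

(** * Independent standard normal families *)

Section Family.
Context (R : realType) (d : measure_display) (T : measurableType d).
Variable P : probability T R.
Local Open Scope ereal_scope.
Local Notation gamma := (@normal_prob R 0%R 1%R).

(** Independence and the marginal laws in a single formula: some of the B i may
    be the whole line. *)
Definition gaussian_family (I : finType) (X : I -> {RV P >-> R}) : Prop :=
  forall B : I -> set R, (forall i, measurable (B i)) ->
    P [set w | forall i, B i (X i w)] = \prod_(i : I) gamma (B i).

Lemma gaussian_mx_family m n (X : 'M[{RV P >-> R}]_(m, n)) :
  gaussian_mx X <-> gaussian_family (fun ij : 'I_m * 'I_n => X ij.1 ij.2).
Proof.
have cap (B : 'I_m * 'I_n -> set R) :
    \bigcap_(ij in [set: 'I_m * 'I_n]) (X ij.1 ij.2 @^-1` B ij) =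
    [set w | forall ij, B ij (X ij.1 ij.2 w)].
  by apply/seteqP; split => w /= H ij; [exact: H|move=> _; exact: H].
split=> [[XP XI] B mB|XF].
  rewrite -cap XI//; apply: eq_bigr => ij _.
  by rewrite -(XP ij.1 ij.2 _ (mB ij)).
have one i j (B : set R) : measurable B -> P (X i j @^-1` B) = gamma B.
  move=> mB; pose B' (ij : 'I_m * 'I_n) := if ij == (i, j) then B else setT.
  have mB' ij : measurable (B' ij) by rewrite /B'; case: ifP.
  have := XF _ mB'; rewrite (bigD1 (i, j))//= big1 ?mule1 => [|ij /negPf ne].
    rewrite /B' eqxx => <-; congr (P _); apply/seteqP; split => w /=.
      by move=> Bw ij; case: eqP => // ->.
    by move=> /(_ (i, j)); rewrite eqxx.
  by rewrite /B' ne probability_setT.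
split=> // B mB; rewrite cap XF//; apply: eq_bigr => ij _.
by rewrite one.
Qed.

Lemma measurable_family_event (I : finType) (X : I -> {RV P >-> R})
    (B : I -> set R) : (forall i, measurable (B i)) ->
  measurable [set w | forall i, B i (X i w)].
Proof.
move=> mB.
have -> : [set w | forall i, B i (X i w)] =
    \bigcap_(i in [set: I]) (X i @^-1` B i).
  by apply/seteqP; split => w /= H i; [move=> _|]; exact: H.
apply: fin_bigcap_measurable => [|i _]; first exact: finite_finset.
by rewrite -[X in measurable X]setTI; exact: measurable_funP.
Qed.

(** Restrict P to the event E that prescribes the other coordinates.  The law
    of the pair (X i, X j) under this restriction is P(E) times the planar
    normal law, because both agree on rectangles, and the latter is invariant
    under the rotation. *)
Lemma gaussian_family_rotate (I : finType) (X Y : I -> {RV P >-> R}) (i j : I)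
    (c s : R) : i != j -> s != 0%R -> (c ^+ 2 + s ^+ 2 = 1)%R ->
  (forall w, Y i w = c * X i w + s * X j w)%R ->
  (forall w, Y j w = - s * X i w + c * X j w)%R ->
  (forall k w, k != i -> k != j -> Y k w = X k w) ->
  gaussian_family X -> gaussian_family Y.
Proof.
move=> ij s0 cs Yi Yj Yk XF B mB.
pose E0 (A C : set R) k := if k == i then A else if k == j then C else B k.
have mE0 A C : measurable A -> measurable C -> forall k, measurable (E0 A C k).
  by move=> mA mC k; rewrite /E0; case: ifP => // _; case: ifP.
pose E := [set w | forall k, E0 setT setT k (X k w)].
have mE : measurable E by apply: measurable_family_event; exact: mE0.
have prodE A C : \prod_k gamma (E0 A C k) =
    gamma A * (gamma C * \prod_(k | (k != i) && (k != j)) gamma (B k)).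
  rewrite (bigD1 i)//= (bigD1 j)//=; last by rewrite eq_sym.
  rewrite /E0 eqxx eq_sym (negPf ij) eqxx; congr (_ * (_ * _)).
  by apply: eq_bigr => k /andP[/negPf -> /negPf ->].
have PE : P E = \prod_(k | (k != i) && (k != j)) gamma (B k).
  by rewrite XF ?prodE ?probability_setT ?mul1e//; exact: mE0.
pose phi (w : T) : measurableTypeR R * measurableTypeR R := (X i w, X j w).
have mphi : measurable_fun setT phi.
  have mX k : measurable_fun setT (X k : T -> measurableTypeR R).
    exact: (measurable_funP (X k)).
  exact: measurable_fun_pair.
pose nu := pushforward (mrestr P mE) phi.
have nuX A C : measurable A -> measurable C ->
    nu (A `*` C) = P E * (gamma A * gamma C).
  move=> mA mC; rewrite muleC -muleA PE -prodE -XF; last exact: mE0.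
  rewrite /nu /pushforward /mrestr; congr (P _); apply/seteqP; split => w /=.
    move=> [[Aw Cw] Ew] k; move: (Ew k); rewrite /E0.
    by case: eqP => [->|_]//; case: eqP => [->|_].
  move=> H; split.
    by have := H i; have := H j; rewrite /E0 !eqxx eq_sym (negPf ij).
  move=> k; have := H k; rewrite /E0.
  by case: eqP => // _; case: eqP.
pose S := [set z : measurableTypeR R * measurableTypeR R |
  B i (c * z.1 + s * z.2)%R /\ B j (- s * z.1 + c * z.2)%R].
have mS : measurable S.
  pose rot (z : measurableTypeR R * measurableTypeR R) :
    measurableTypeR R * measurableTypeR R :=
    (c * z.1 + s * z.2, - s * z.1 + c * z.2)%R.
  have mrot : measurable_fun setT rot.
    by apply: measurable_fun_pair; apply: measurable_funD => //;
      apply: measurable_funM.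
  have -> : S = rot @^-1` (B i `*` B j) by [].
  rewrite -[X in measurable X]setTI; apply: mrot => //; apply: measurableX; exact: mB.
have nuS : nu S = P E * (gamma (B i) * gamma (B j)).
  have PEfin : P E \is a fin_num by exact: fin_num_measure.
  have [e0|e0] := eqVneq (P E) 0.
    rewrite e0 mul0e; apply/eqP; rewrite eq_le /nu /pushforward /mrestr.
    rewrite measure_ge0 andbT -e0 le_measure ?inE//.
    by apply: measurableI => //; rewrite -[X in measurable X]setTI; exact: mphi.
  have r0 : (0 <= (fine (P E))^-1)%R by rewrite invr_ge0 fine_ge0.
  have rE : (fine (P E))^-1%:E * P E = 1.
    by rewrite -{2}(fineK PEfin) -EFinM mulVf// fine_eq0.
  have <- : (gamma \x gamma) S = gamma (B i) * gamma (B j).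
    exact: normal2_rotation.
  have -> : (gamma \x gamma) S =
      pushforward (mscale (NngNum r0) (mrestr P mE)) phi S.
    apply: product_measure_unique => // A C mA mC.
    transitivity ((fine (P E))^-1%:E * nu (A `*` C)); first by [].
    by rewrite nuX// muleA rE mul1e.
  transitivity ((fine (P E))^-1%:E * P E * nu S); first by rewrite rE mul1e.
  by rewrite [_ * P E]muleC -muleA.
transitivity (nu S).
  rewrite /nu /pushforward /mrestr; congr (P _); apply/seteqP; split => w /=.
    move=> H; split; first by split; rewrite /phi/= -?Yi -?Yj; exact: H.
    move=> k; rewrite /E0; case: eqP => // /eqP ki; case: eqP => // /eqP kj.
    by rewrite -Yk.
  move=> [[Hi Hj] H] k; have [->|ki] := eqVneq k i; first by rewrite Yi.
  have [->|kj] := eqVneq k j; first by rewrite Yj.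
  by have := H k; rewrite /E0 (negPf ki) (negPf kj) Yk.
rewrite nuS PE muleC -muleA -prodE; apply: eq_bigr => k _.
by rewrite /E0; case: eqP => [->//|_]; case: eqP => [->|].
Qed.
End Family.

(** * Triangularization by Givens rotations *)

Section Givens.
Variable R : realType.

(** The rotation of cosine c and sine s in the plane of the coordinates a and b. *)
Definition givens (m : nat) (a b : 'I_m) (c s : R) : 'M[R]_m :=
  \matrix_(i, j) if i == a then c * (j == a)%:R + s * (j == b)%:R
    else if i == b then - s * (j == a)%:R + c * (j == b)%:R else (j == i)%:R.

Lemma mul_givens (m n : nat) (a b : 'I_m) (c s : R) (M : 'M[R]_(m, n)) i j :
  (givens a b c s *m M) i j =
    if i == a then c * M a j + s * M b j
    else if i == b then - s * M a j + c * M b j else M i j.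
Proof.
have sum1 k : \sum_l (l == k)%:R * M l j = M k j.
  rewrite (bigD1 k)//= eqxx mul1r big1 ?addr0// => l /negPf ->.
  by rewrite mul0r.
have sum2 (u v : R) :
    \sum_l (u * (l == a)%:R + v * (l == b)%:R) * M l j = u * M a j + v * M b j.
  under eq_bigr do rewrite mulrDl -!mulrA.
  by rewrite big_split/= -!mulr_sumr !sum1.
rewrite mxE; under eq_bigr do rewrite mxE.
by case: eqP => // _; case: eqP.
Qed.

Lemma givens_orthogonal (m : nat) (a b : 'I_m) (c s : R) :
  a != b -> c ^+ 2 + s ^+ 2 = 1 ->
  (givens a b c s)^T *m givens a b c s = 1%:M.
Proof.
move=> ab cs; apply: mulmx1C; apply/matrixP => i j; rewrite mul_givens !mxE.
have ba : (b == a) = false by rewrite eq_sym; apply/negbTE.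
rewrite !(eq_sym _ j) (negPf ab) ba !eqxx /=.
have [ja|ja] := eqVneq j a; have [ia|ia] := eqVneq i a;
  rewrite ?ia ?ja ?(negPf ab) ?ba ?eqxx /=; [lra| | |].
- by rewrite [a == i]eq_sym (negPf ia); case: eqVneq => [_|_] /=; lra.
- by rewrite (negPf ja); case: eqVneq => [_|_] /=; lra.
have [ib|ib] := eqVneq i b; have [jb|jb] := eqVneq j b;
  rewrite ?ib ?jb ?eqxx ?(negPf ib) ?(negPf jb) ?[b == i]eq_sym ?(negPf ib) /=; try lra.
Qed.

(** Rotating the rows k and i > k creates a zero at (i, k), and does not disturb
    the zeros below the diagonal in the columns to the left of k.  Columns are
    treated from left to right and entries of a column from top to bottom; the
    class C collects what is known of the product of the rotations. *)
Lemma givens_triangular (m q : nat) (U : 'M[R]_(m, q)) (C : 'M[R]_m -> Prop) :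
  C 1%:M -> (forall A B, C A -> C B -> C (A *m B)) ->
  (forall a b c s, a != b -> s != 0 -> c ^+ 2 + s ^+ 2 = 1 -> C (givens a b c s)) ->
  exists2 Q, C Q & forall (i : 'I_m) (j : 'I_q), (j < i)%N -> (Q *m U) i j = 0.
Proof.
move=> C1 CM CG.
suff /(_ q) [Q CQ Q0] : forall k, exists2 Q, C Q &
    forall (i : 'I_m) (j : 'I_q), (j < k)%N -> (j < i)%N -> (Q *m U) i j = 0.
  by exists Q => // i j; exact: Q0.
elim=> [|k [Q0 CQ0 Q0U]]; first by exists 1%:M.
have [qk|kq] := leqP q k.
  by exists Q0 => // i j _ ij; apply: Q0U => //; apply: leq_trans qk.
pose kk := Ordinal kq.
suff /(_ m) [Q CQ [QU QUk]] : forall t, exists2 Q, C Q &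
    (forall (i : 'I_m) (j : 'I_q), (j < k)%N -> (j < i)%N -> (Q *m U) i j = 0) /\
    (forall i : 'I_m, (k < i < k.+1 + t)%N -> (Q *m U) i kk = 0).
  exists Q => // i j; rewrite ltnS leq_eqVlt => /predU1P[jk|jk] ij; last exact: QU.
  have -> : j = kk by exact: val_inj.
  by apply: QUk; rewrite -jk ij/= (leq_trans (ltn_ord i))// leq_addl.
elim=> [|t [Q1 CQ1 [Q1U Q1Uk]]].
  exists Q0 => //; split=> // i; rewrite addn0 ltnS.
  by move=> /andP[/leq_trans/[apply]]; rewrite ltnn.
have [mt|tm] := leqP m (k.+1 + t).
  exists Q1 => //; split=> // i /andP[ki _]; apply: Q1Uk.
  by rewrite ki (leq_trans (ltn_ord i)).
have km : (k < m)%N by apply: leq_trans tm; rewrite ltnS addSn leqW// leq_addr.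
pose a := Ordinal km; pose b := Ordinal tm.
have ab : a != b by rewrite -val_eqE/= neq_ltn addSn ltnS leq_addr.
have [y0|y0] := eqVneq ((Q1 *m U) b kk) 0.
  exists Q1 => //; split=> // i /andP[ki]; rewrite addnS ltnS leq_eqVlt.
  case/predU1P=> [it|it]; last by apply: Q1Uk; rewrite ki.
  by have -> : i = b by exact: val_inj.
set x := (Q1 *m U) a kk; set y := (Q1 *m U) b kk in y0 *.
have r0 : 0 < x ^+ 2 + y ^+ 2.
  by rewrite ltr_wpDl ?sqr_ge0// lt_neqAle sqr_ge0 andbT eq_sym sqrf_eq0.
pose r := Num.sqrt (x ^+ 2 + y ^+ 2).
have rr : r != 0 by rewrite gt_eqF// sqrtr_gt0.
have r2 : r ^+ 2 = x ^+ 2 + y ^+ 2 by rewrite sqr_sqrtr// ltW.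
exists (givens a b (x / r) (y / r) *m Q1).
  apply: CM => //; apply: CG => //; first by rewrite mulf_neq0// invr_neq0.
  by rewrite !expr_div_n -mulrDl -r2 mulfV// expf_neq0.
rewrite -mulmxA; split=> [i j jk ji|i /andP[ki]]; rewrite mul_givens.
  rewrite ![(Q1 *m U) _ j]Q1U// ?mulr0 ?addr0; first by rewrite !if_same.
  by rewrite /= addSn ltnS (leq_trans (ltnW jk))// leq_addr.
rewrite addnS ltnS -/x -/y.
have -> : (i == a) = false by apply/negbTE; rewrite -val_eqE/= gtn_eqF.
case: (eqVneq i b) => [_ _|ib it]; first by rewrite mulNr; field.
apply: Q1Uk; rewrite ki/= ltn_neqAle it andbT.
by move: ib; rewrite -val_eqE.
Qed.

End Givens.

Section Rotation.
Context (R : realType) (d : measure_display) (T : measurableType d).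
Variable P : probability T R.

Section LinRV.
Variables (c s : R) (X Y : {RV P >-> R}).
Let f w := c * X w + s * Y w.
Let mf : measurable_fun setT f.
Proof.
by apply: measurable_funD; apply: measurable_funM => //; exact: measurable_funP.
Qed.
HB.instance Definition _ := isMeasurableFun.Build _ _ _ _ f mf.
Definition linRV : {RV P >-> R} := f.
End LinRV.

(** The columns of X are rotated one after the other; Z t is the state after t
    columns, and each step rotates the single pair of entries (a, t), (b, t). *)
Lemma gaussian_mx_givens (m r : nat) (a b : 'I_m) (c s : R)
    (X : 'M[{RV P >-> R}]_(m, r)) : a != b -> s != 0 -> c ^+ 2 + s ^+ 2 = 1 ->
  gaussian_mx X -> exists2 Y : 'M[{RV P >-> R}]_(m, r), gaussian_mx Y &
    forall w, sample_mx Y w = givens a b c s *m sample_mx X w.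
Proof.
move=> ab s0 cs GX.
pose Y : 'M[{RV P >-> R}]_(m, r) := \matrix_(i, j)
  if i == a then linRV c s (X a j) (X b j)
  else if i == b then linRV (- s) c (X a j) (X b j) else X i j.
exists Y; last first.
  move=> w; apply/matrixP => i j; rewrite mul_givens !mxE.
  by case: ifP => // _; case: ifP.
pose Z (t : nat) : 'M[{RV P >-> R}]_(m, r) :=
  \matrix_(i, j) if (j < t)%N then Y i j else X i j.
have -> : Y = Z r by apply/matrixP => i j; rewrite [RHS]mxE ltn_ord.
suff : forall t, (t <= r)%N -> gaussian_mx (Z t) by apply.
elim=> [_|t IH tr].
  by have -> : Z 0%N = X by apply/matrixP => i j; rewrite mxE.
apply/gaussian_mx_family; have /gaussian_mx_family := IH (ltnW tr).
pose j0 := Ordinal tr.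
have ba : (b == a) = false by rewrite eq_sym; apply/negbTE.
apply: (gaussian_family_rotate (i := (a, j0)) (j := (b, j0)) _ s0 cs).
- by rewrite xpair_eqE negb_and ab.
- by move=> w; rewrite !mxE/= ltnn ltnSn eqxx.
- by move=> w; rewrite !mxE/= ltnn ltnSn eqxx ba.
- move=> [i j] w; rewrite !xpair_eqE/= !negb_and => ia ib; rewrite !mxE/= ltnS.
  have [//|//|jt] := ltngtP j t.
  have jj : j == j0 by apply/eqP/val_inj.
  by move: ia ib; rewrite jj /= !orbF => /negPf -> /negPf ->.
Qed.

(** The orthogonal Q is chosen from U alone; as a product of Givens rotations,
    it maps Gaussian matrices to Gaussian matrices. *)
Lemma gaussian_triangular (m q r : nat) (U : 'M[R]_(m, q))
    (X : 'M[{RV P >-> R}]_(m, r)) : gaussian_mx X ->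
  exists Q : 'M[R]_m, exists2 Y : 'M[{RV P >-> R}]_(m, r),
    gaussian_mx Y /\ (forall w, sample_mx Y w = Q *m sample_mx X w) &
    Q^T *m Q = 1%:M /\
    forall (i : 'I_m) (j : 'I_q), (j < i)%N -> (Q *m U) i j = 0.
Proof.
move=> GX.
pose C (Q : 'M[R]_m) := Q^T *m Q = 1%:M /\
  forall X : 'M[{RV P >-> R}]_(m, r), gaussian_mx X ->
  exists2 Y : 'M[{RV P >-> R}]_(m, r), gaussian_mx Y &
    forall w, sample_mx Y w = Q *m sample_mx X w.
have [||a b c s ab s0 cs|Q [QQ /(_ X GX)[Y GY YE]] QU] :=
    @givens_triangular R m q U C.
- split; first by rewrite trmx1 mulmx1.
  by move=> X' GX'; exists X' => // w; rewrite mul1mx.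
- move=> A B [AA CA] [BB CB]; split.
    by rewrite trmx_mul -mulmxA (mulmxA A^T) AA mul1mx.
  move=> X0 /CB[X1 /CA[X2 GX2 X2E] X1E].
  by exists X2 => // w; rewrite X2E X1E mulmxA.
- by split; [exact: givens_orthogonal|move=> X0; exact: gaussian_mx_givens].
by exists Q, Y.
Qed.

(** Prescribing the whole line for the indices out of the range of h adds a
    factor 1. *)
Lemma gaussian_family_inj (I J : finType) (h : J -> I) (X : I -> {RV P >-> R}) :
  injective h -> gaussian_family X -> gaussian_family (fun x => X (h x)).
Proof.
move=> hi XF B mB.
pose B' y := if [pick x | h x == y] is Some x then B x else setT.
have B'h x : B' (h x) = B x.
  by rewrite /B'; case: pickP => [y /eqP/hi ->//|/(_ x)]; rewrite eqxx.
have B'n y : (forall x, h x != y) -> B' y = setT.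
  by move=> hy; rewrite /B'; case: pickP => // x; rewrite (negPf (hy x)).
have mB' y : measurable (B' y) by rewrite /B'; case: pickP.
have := XF B' mB'.
have -> : [set w | forall y, B' y (X y w)] = [set w | forall x, B x (X (h x) w)].
  apply/seteqP; split => w /= H x; first by have := H (h x); rewrite B'h.
  have [[y /eqP yx]|hx] := pselect (exists y, h y == x).
    by rewrite -yx B'h.
  by rewrite B'n// => y; apply/negP => yx; apply: hx; exists y.
move=> ->; rewrite (bigID (mem (h @: [set: J]%SET)))/= [X in (_ * X)%E]big1 ?mule1.
  rewrite big_imset /=; last by move=> x y _ _ /hi.
  by apply: eq_big => [x|x _]; rewrite ?inE ?B'h.
move=> y hy; rewrite B'n ?probability_setT// => x.
by apply: contraNneq hy => <-; rewrite imset_f.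
Qed.

Lemma gaussian_mxsub m n m' n' (f : 'I_m' -> 'I_m) (g : 'I_n' -> 'I_n)
    (X : 'M[{RV P >-> R}]_(m, n)) : injective f -> injective g ->
  gaussian_mx X -> gaussian_mx (mxsub f g X).
Proof.
move=> fi gi /gaussian_mx_family XF; apply/gaussian_mx_family.
pose h (ij : 'I_m' * 'I_n') := (f ij.1, g ij.2).
have hi : injective h by move=> [i j] [i' j'] [/fi -> /gi ->].
have -> : (fun ij => mxsub f g X ij.1 ij.2) = (fun x => X (h x).1 (h x).2).
  by apply/funext => ij; rewrite mxE.
exact: (gaussian_family_inj hi XF).
Qed.

Lemma gaussian_trmx m n (X : 'M[{RV P >-> R}]_(m, n)) :
  gaussian_mx X -> gaussian_mx X^T.
Proof.
move=> /gaussian_mx_family XF; apply/gaussian_mx_family.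
pose h (ij : 'I_n * 'I_m) := (ij.2, ij.1).
have hi : injective h by move=> [i j] [i' j'] [-> ->].
have -> : (fun ij => X^T ij.1 ij.2) = (fun x => X (h x).1 (h x).2).
  by apply/funext => ij; rewrite mxE.
exact: (gaussian_family_inj hi XF).
Qed.

End Rotation.

(** * Almost sure invertibility of Gaussian matrices *)

Section FirstEntry.
Context (R : realType) (d : measure_display) (T : measurableType d).
Variable P : probability T R.
Local Open Scope ereal_scope.
Local Notation gamma := (@normal_prob R 0%R 1%R).

(** A pi-system generating the sigma-algebra of all variables but X i0; the
    condition on B i0 leaves X i0 free. *)
Definition cylinders_off (I : finType) (X : I -> {RV P >-> R}) (i0 : I) :
    set (set T) :=
  [set E | exists2 B : I -> set R, (forall i, measurable (B i)) &
     B i0 = setT /\ E = [set w | forall i, B i (X i w)]].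

Notation others X i0 := (g_sigma_algebraType (cylinders_off X i0)).

Lemma measurable_others (I : finType) (X : I -> {RV P >-> R}) (i0 i : I) :
  i != i0 -> measurable_fun setT (X i : others X i0 -> R).
Proof.
move=> ii0 _ A mA; rewrite setTI; apply: sub_sigma_algebra.
exists (fun k => if k == i then A else setT).
  by move=> k; case: ifP.
split; first by rewrite eq_sym (negPf ii0).
apply/seteqP; split => w /= H; first by move=> k; case: eqP => // ->.
by have := H i; rewrite eqxx.
Qed.

Lemma measurable_others_id (I : finType) (X : I -> {RV P >-> R}) (i0 : I) :
  measurable_fun setT (fun w : T => w : others X i0).
Proof.
move=> _ E mE; rewrite setTI preimage_id.
apply: (smallest_sub _ _ mE); first exact: sigma_algebra_measurable.
by move=> _ [B mB [_ ->]]; exact: measurable_family_event.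
Qed.

(** For a fixed A, both sides are finite measures in E that agree on the
    pi-system of cylinders. *)
Lemma gaussian_family_independent (I : finType) (X : I -> {RV P >-> R}) (i0 : I)
    (A : set R) (E : set (others X i0)) : gaussian_family X ->
  measurable A -> measurable E ->
  P (X i0 @^-1` A `&` E) = gamma A * P E.
Proof.
move=> XF mA mE.
have mXA : measurable (X i0 @^-1` A).
  by rewrite -[X in measurable X]setTI; exact: measurable_funP.
have mid := @measurable_others_id I X i0.
have fA : gamma A \is a fin_num by exact: fin_num_measure.
have A0 : (0 <= fine (gamma A))%R by rewrite fine_ge0.
suff : pushforward (mrestr P mXA) (fun w : T => w : others X i0) E =
       pushforward (mscale (NngNum A0) P) (fun w : T => w : others X i0) E.
  by rewrite /pushforward /mrestr /mscale/= fineK// preimage_id setIC.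
apply: (@measure_unique _ R (others X i0) (cylinders_off X i0) (fun=> setT)) => //.
- move=> _ _ [B mB [B0 ->]] [C mC [C0 ->]].
  exists (fun i => B i `&` C i); first by move=> i; exact: measurableI.
  split; first by rewrite B0 C0 setIT.
  apply/seteqP; split => [w [/= HB HC] i|w /= H]; first by split.
  by split=> i; have [] := H i.
- move=> _; exists (fun=> setT) => //; split=> //.
  by apply/seteqP; split.
- by rewrite bigcup_const//; exists 0%N.
- move=> _ [B mB [B0 ->]].
  set F := [set w | _].
  suff H : P (F `&` X i0 @^-1` A) = gamma A * P F.
    by rewrite -(fineK fA) in H; exact: H.
  pose B' i := if i == i0 then A else B i.
  have mB' i : measurable (B' i) by rewrite /B'; case: ifP.
  have -> : F `&` X i0 @^-1` A =
      [set w | forall i, B' i (X i w)].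
    apply/seteqP; split => [w [/= HB HA] i|w /= H].
      by rewrite /B'; case: eqP => [->|].
    split; last by have := H i0; rewrite /B' eqxx.
    by move=> i; have := H i; rewrite /B'; case: eqP => // ->; rewrite B0.
  rewrite /F !XF// (bigD1 i0)//= [in RHS](bigD1 i0)//= B0 probability_setT mul1e.
  rewrite /B' eqxx; congr (_ * _); apply: eq_bigr => i /negPf ii0.
  by rewrite ii0.
- move=> _; suff H : P (setT `&` X i0 @^-1` A) < +oo by exact: H.
  by rewrite setTI -ge0_fin_numE//; exact: fin_num_measure.
Qed.

Lemma normal_prob1 (a : R) : gamma [set a] = 0.
Proof.
have /null_content_dominatesP dom : gamma `<< @lebesgue_measure R.
  exact: normal_prob_dominates.
by apply: dom => //; exact: lebesgue_measure_set1.
Qed.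

(** By independence, the law of w |-> (w, X i0 w) is a product measure.  The bad
    event is the preimage of a set whose section at w is contained in the
    single root of an affine function with nonzero slope, which the normal law
    does not charge. *)
Lemma ae_affine_neq0 (I : finType) (X : I -> {RV P >-> R}) (i0 : I)
    (C D : others X i0 -> R) : gaussian_family X ->
  measurable_fun setT C -> measurable_fun setT D ->
  {ae P, forall w, C w != 0%R} -> {ae P, forall w, C w * X i0 w + D w != 0}%R.
Proof.
move=> XF mC mD aeC.
pose S := [set z : others X i0 * measurableTypeR R |
  C z.1 != 0%R /\ (C z.1 * z.2 + D z.1 = 0)%R].
have mS : measurable S.
  pose f (z : others X i0 * measurableTypeR R) : R := (C z.1 * z.2 + D z.1)%R.
  have mC1 : measurable_fun setT (fun z : others X i0 * measurableTypeR R => C z.1).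
    exact: measurableT_comp.
  have mf : measurable_fun setT f.
    apply: measurable_funD; last exact: measurableT_comp.
    by apply: measurable_funM.
  have -> : S = ((C \o fst) @^-1` (~` [set 0%R])) `&` (f @^-1` [set 0%R]).
    by apply/seteqP; split => z /= [/eqP].
  apply: measurableI; rewrite -[X in measurable X]setTI.
    by apply: mC1 => //; exact: measurableC.
  exact: mf.
have mid := @measurable_others_id I X i0.
pose phi (w : T) : others X i0 * measurableTypeR R := (w, X i0 w).
have mphi : measurable_fun setT phi.
  have mX : measurable_fun setT (X i0 : T -> measurableTypeR R).
    exact: (measurable_funP (X i0)).
  exact: measurable_fun_pair.
have S0 : pushforward P phi S = 0.
  pose Q : probability (others X i0) R := distribution P
    (HB.pack (fun w : T => w : others X i0)
       (isMeasurableFun.Build _ _ _ _ _ mid) : {mfun T >-> others X i0}).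
  have <- : (Q \x gamma) S = pushforward P phi S.
    apply: product_measure_unique => // E A mE mA.
    rewrite [RHS]muleC; have := gaussian_family_independent XF mA mE => <-.
    by rewrite setIC.
  rewrite /product_measure1 integral0_eq// => w _ /=.
  have [C0|C0] := eqVneq (C w) 0%R.
    rewrite (_ : xsection S w = set0) ?measure0//.
    apply/seteqP; split => // x; rewrite /xsection/= inE => -[/=].
    by rewrite C0 eqxx.
  apply/eqP; rewrite eq_le measure_ge0 andbT.
  rewrite -(normal_prob1 (- D w / C w)) le_measure ?inE//.
    exact: measurable_xsection.
  move=> x; rewrite /xsection/= inE => -[_ /= /eqP]; rewrite addr_eq0 => /eqP <-.
  by rewrite mulrC mulKf.
have ae1 : {ae P, forall w, ~ S (phi w)}.
  exists (phi @^-1` S); split => //.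
    by rewrite -[X in measurable X]setTI; exact: mphi.
  by move=> w /=; rewrite notK.
apply: filterS2 ae1 aeC => w NS C0; apply/eqP => CD; exact: NS.
Qed.
End FirstEntry.

Section Determinant.
Context (R : realType).

Lemma measurable_det d' (T' : measurableType d') n (M : T' -> 'M[R]_n) :
  (forall i j, measurable_fun setT (fun w => M w i j)) ->
  measurable_fun setT (fun w => \det (M w)).
Proof.
move=> mM; apply: measurable_sum => s; apply: measurable_funM => //.
by apply: measurable_prod => i _; exact: mM.
Qed.

Context (d : measure_display) (T : measurableType d) (P : probability T R).

(** Expansion along the first row makes the determinant affine in the top left
    entry; its slope is the cofactor of this entry, a Gaussian determinant of
    smaller size. *)
Lemma ae_det_gaussian_neq0 n (X : 'M[{RV P >-> R}]_n) :
  gaussian_mx X -> {ae P, forall w, \det (sample_mx X w) != 0}.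
Proof.
elim: n X => [|n IH] X GX.
  by apply: aeW => w; rewrite det_mx00 oner_neq0.
pose X' (ij : 'I_n.+1 * 'I_n.+1) := X ij.1 ij.2.
have XF : gaussian_family X' by apply/gaussian_mx_family.
pose C w := cofactor (sample_mx X w) 0 0.
pose D w := \sum_(j < n)
  sample_mx X w 0 (lift 0 j) * cofactor (sample_mx X w) 0 (lift 0 j).
pose Others := g_sigma_algebraType (cylinders_off X' (0, 0)).
have detE w : \det (sample_mx X w) = C w * X' (0, 0) w + D w.
  rewrite (expand_det_row _ 0) big_ord_recl [X in X * _]mxE mulrC.
  by [].
have GY : gaussian_mx (mxsub (lift 0) (lift 0) X).
  by apply: gaussian_mxsub => //; exact: lift_inj.
have C0 : {ae P, forall w, C w != 0}.
  apply: filterS (IH _ GY) => w.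
  suff -> : C w = \det (sample_mx (mxsub (lift 0) (lift 0) X) w) by [].
  rewrite /C /cofactor expr0 mul1r; congr (\det _).
  by apply/matrixP => i j; rewrite !mxE.
have mcof j : measurable_fun setT
    ((fun w => cofactor (sample_mx X w) 0 j) : Others -> R).
  apply: measurable_funM => //; apply: measurable_det => i k.
  rewrite [X in measurable_fun _ X]
    (_ : _ = (X' (lift 0 i, lift j k) : T -> R)); last first.
    by apply/funext => w; rewrite !mxE.
  by apply: measurable_others; rewrite xpair_eqE.
have mD : measurable_fun setT (D : Others -> R).
  apply: measurable_sum => j; apply: measurable_funM => //.
  rewrite [X in measurable_fun _ X](_ : _ = (X' (0, lift 0 j) : T -> R)); last first.
    by apply/funext => w; rewrite mxE.
  by apply: measurable_others; rewrite xpair_eqE.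
have H : {ae P, forall w : T, C w * X' (0, 0) w + D w != 0}.
  exact: ae_affine_neq0 XF (mcof 0) mD C0.
by apply: filterS H => w; rewrite detE.
Qed.

(** The leading square block is already invertible. *)
Lemma ae_row_free_gaussian k h (X : 'M[{RV P >-> R}]_(k, h)) : (k <= h)%N ->
  gaussian_mx X -> {ae P, forall w, row_free (sample_mx X w)}.
Proof.
move=> kh GX.
have GY : gaussian_mx (mxsub id (widen_ord kh) X).
  by apply: gaussian_mxsub => // i j /(congr1 val)/= /val_inj.
apply: filterS (ae_det_gaussian_neq0 GY) => w dY.
rewrite /row_free eqn_leq rank_leq_row.
have {1}<- : \rank (sample_mx (mxsub id (widen_ord kh) X) w) = k.
  by apply: mxrank_unit; rewrite unitmxE unitfE.
have -> : sample_mx (mxsub id (widen_ord kh) X) w =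
    sample_mx X w *m colsub (widen_ord kh) 1%:M.
  by rewrite mulmx_colsub mulmx1; apply/matrixP => i j; rewrite !mxE.
exact: mxrankM_maxl.
Qed.
End Determinant.

(** * Low-rank Gaussian preconditioning *)

(** The witnesses G and F are the lower and upper blocks of Q X.  The
    deterministic bound applies to every outcome for which G and H have full row
    rank, which is almost every outcome because both are Gaussian and wide. *)
Lemma gaussian_preconditioning (R : realType) (d : measure_display)
    (T : measurableType d) (P : probability T R) (p q n r : nat)
    (U : 'M[R]_(q + p, q)) (X : 'M[{RV P >-> R}]_(q + p, r))
    (H : 'M[{RV P >-> R}]_(r, n)) :
  spectral_norm U = 1 -> \rank U = q -> (p <= r)%N -> (r <= n)%N ->
  gaussian_mx X -> gaussian_mx H ->
  exists (G : 'M[{RV P >-> R}]_(p, r)) (F : 'M[{RV P >-> R}]_(q, r)),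
    [/\ gaussian_mx G, gaussian_mx F &
      {ae P, forall w,
        let K := row_mx U (sample_mx X w *m sample_mx H w) in
        full_rank K /\
        spectral_norm (mp_pinv K) <=
          spectral_norm (mp_pinv U)
          * Num.max 1 (spectral_norm (mp_pinv (sample_mx G w))
                       * spectral_norm (mp_pinv (sample_mx H w)))
          * (1 + spectral_norm (sample_mx F w)
                 * spectral_norm (sample_mx H w))}].
Proof.
move=> nU rU pr rn GX GH.
have [Q [Y [GY YE] [QQ QU]]] := gaussian_triangular U GX.
have GG : gaussian_mx (dsubmx Y).
  by rewrite dsubmxEsub; apply: gaussian_mxsub => //; exact: rshift_inj.
have GF : gaussian_mx (usubmx Y).
  by rewrite usubmxEsub; apply: gaussian_mxsub => //; exact: lshift_inj.
exists (dsubmx Y), (usubmx Y); split=> //.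
apply: filterS2 (ae_row_free_gaussian pr GG) (ae_row_free_gaussian rn GH) => w.
have -> : sample_mx (dsubmx Y) w = dsubmx (Q *m sample_mx X w).
  by rewrite -YE; apply/matrixP => i j; rewrite !mxE.
have -> : sample_mx (usubmx Y) w = usubmx (Q *m sample_mx X w).
  by rewrite -YE; apply/matrixP => i j; rewrite !mxE.
move=> fG fH; apply: mp_pinv_extend_low_rank => //.
apply/matrixP => i j; rewrite mxE [RHS]mxE; apply: QU => /=.
by rewrite (leq_trans (ltn_ord j))// leq_addr.
Qed.

Theorem theorem6p1 (R : realType) (d : measure_display) (T : measurableType d)
    (P : probability T R) (m n q rho : nat)
    (m_gt0 : (0 < m)%N) (n_gt0 : (0 < n)%N) (q_gt0 : (0 < q)%N)
    (rho_gt0 : (0 < rho)%N) (rho_lt_n : (rho < n)%N)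
    (eta : R) (eta_gt0 : 0 < eta) (threshold : R)
    (U : 'M[R]_(m, q)) (normU : spectral_norm U = 1)
    (numrankU : eta < singular_value U (minn m q))
    (Ubar : 'M[{RV P >-> R}]_(m, rho)) (gaussUbar : gaussian_mx Ubar)
    (Vbar : 'M[{RV P >-> R}]_(n, rho)) (gaussVbar : gaussian_mx Vbar) :
  let A (w : T) : 'M[R]_(m, n) := sample_mx Ubar w *m (sample_mx Vbar w)^T in
  let K (w : T) : 'M[R]_(m, q + n) := row_mx U (A w) in
  (exists (G : 'M[{RV P >-> R}]_(m, rho)) (H : 'M[{RV P >-> R}]_(rho, n)),
     [/\ gaussian_mx G, gaussian_mx H &
         forall w,
           spectral_norm (K w) <= spectral_norm (A w) + spectral_norm U
             <= 1 + spectral_norm (sample_mx G w)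
                    * spectral_norm (sample_mx H w)]) /\
  ((q + rho < m)%N ->
     {ae P, forall w, ~~ full_rank (K w) \/ ill_conditioned threshold (K w)}) /\
  ((m <= q + rho)%N -> {ae P, forall w, full_rank (K w)}) /\
  ((m <= q)%N ->
     {ae P, forall w,
        spectral_norm (mp_pinv (K w)) <= spectral_norm (mp_pinv U)}) /\
  ((m <= q + rho)%N -> (q < m)%N ->
     exists (G : 'M[{RV P >-> R}]_(m - q, rho))
            (H : 'M[{RV P >-> R}]_(rho, n))
            (F : 'M[{RV P >-> R}]_(q, rho)),
       [/\ gaussian_mx G, gaussian_mx H, gaussian_mx F &
           {ae P, forall w,
              spectral_norm (mp_pinv (K w)) <=
              spectral_norm (mp_pinv U)
              * Num.max 1 (spectral_norm (mp_pinv (sample_mx G w))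
                           * spectral_norm (mp_pinv (sample_mx H w)))
              * (1 + spectral_norm (sample_mx F w)
                     * spectral_norm (sample_mx H w))}]).
Proof.
move=> A K.
have rankU : \rank U = minn m q.
  apply/eqP; rewrite eqn_leq leq_min rank_leq_row rank_leq_col/=.
  apply: rank_ge_singular_value; first by rewrite leq_min m_gt0.
  exact: lt_trans numrankU.
have AE w : A w = sample_mx Ubar w *m sample_mx Vbar^T w.
  by congr (_ *m _); apply/matrixP => i j; rewrite !mxE.
have GVt : gaussian_mx Vbar^T by exact: gaussian_trmx.
have fVt : {ae P, forall w, row_free (sample_mx Vbar^T w)}.
  by apply: ae_row_free_gaussian => //; exact: ltnW.
have wide : (q < m)%N -> (m <= q + rho)%N ->
    exists (G : 'M[{RV P >-> R}]_(m - q, rho)) (F : 'M[{RV P >-> R}]_(q, rho)),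
    [/\ gaussian_mx G, gaussian_mx F &
      {ae P, forall w, full_rank (K w) /\
        spectral_norm (mp_pinv (K w)) <=
          spectral_norm (mp_pinv U)
          * Num.max 1 (spectral_norm (mp_pinv (sample_mx G w))
                       * spectral_norm (mp_pinv (sample_mx Vbar^T w)))
          * (1 + spectral_norm (sample_mx F w)
                 * spectral_norm (sample_mx Vbar^T w))}].
  move=> qm mqr; have [p Em] : exists p, m = (q + p)%N.
    by exists (m - q)%N; rewrite subnKC// ltnW.
  rewrite {}/K; have -> : A = fun w => sample_mx Ubar w *m sample_mx Vbar^T w.
    exact/funext.
  move: U Ubar normU rankU gaussUbar {numrankU A AE}; rewrite Em in mqr *.
  rewrite addKn (minn_idPr (leq_addr _ _)) => {}U {}Ubar nU rU GU.
  by apply: gaussian_preconditioning => //; [rewrite -(leq_add2l q)|exact: ltnW].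
split; [|split; [|split; [|split]]].
- exists Ubar, Vbar^T; split=> // w; apply/andP; split.
    by rewrite addrC spectral_norm_row_mx.
  by rewrite addrC normU lerD2l AE spectral_normM.
- move=> qrm; apply: aeW => w; left; rewrite /full_rank neq_ltn.
  suff rK : (\rank (K w) <= q + rho)%N.
    rewrite (leq_ltn_trans rK)// leq_min qrm ltn_add2l rho_lt_n//.
  have -> : K w = row_mx U (sample_mx Ubar w) *m
      block_mx 1%:M 0 0 (sample_mx Vbar^T w).
    by rewrite mul_row_block !mulmx0 mulmx1 addr0 add0r -AE.
  exact: leq_trans (mxrankM_maxl _ _) (rank_leq_col _).
- move=> mqr; have [mq|qm] := leqP m q.
    apply: aeW => w; apply: (mp_pinv_extend_row_free _ _).1.
    by rewrite /row_free rankU; apply/eqP/minn_idPl.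
  have [G [F [_ _ HK]]] := wide qm mqr.
  by apply: filterS HK => w [].
- move=> mq; apply: aeW => w; apply: (mp_pinv_extend_row_free _ _).2.
  by rewrite /row_free rankU; apply/eqP/minn_idPl.
- move=> mqr qm; have [G [F [GG GF HK]]] := wide qm mqr.
  exists G, Vbar^T, F; split=> //.
  by apply: filterS HK => w [].
Qed.
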